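(* (Fundamental theorem of calculus) (a) Let $f\in\mathcal A_c(\mathbb R^2)$ and define $\Phi(x,y)=\int_{-\infty}^x\int_{-\infty}^y f$ for $(x,y)\in\overline{\mathbb R}^2$. Then $\Phi\in\mathcal B_c(\overline{\mathbb R}^2)$ and $\partial_{12}\Phi=f$. (b) Let $G\in C(\overline{\mathbb R}^2)$. Then for all $(x,y)\in\overline{\mathbb R}^2$, $\int_{-\infty}^x\int_{-\infty}^y\partial_{12}G=G(-\infty,-\infty)+G(x,y)-G(-\infty,y)-G(x,-\infty)$.
   Context: $\overline{\mathbb R}=[-\infty,\infty]$ is the two-point compactification of $\mathbb R$, and $\overline{\mathbb R}^2$ carries the product topology. $C(\overline{\mathbb R}^2)$ is the set of continuous real-valued functions on $\overline{\mathbb R}^2$. $\mathcal B_c(\overline{\mathbb R}^2)=\{F\in C(\overline{\mathbb R}^2)\mid F(-\infty,s)=F(s,-\infty)=0 \text{ for all } s\in\overline{\mathbb R}\}$. $\partial_{12}=\partial_1\partial_2$ is the distributional derivative on $\mathbb R^2$: $\langle\partial_{12}F,\phi\rangle=\int_{-\infty}^\infty\int_{-\infty}^\infty F\,\partial_{12}\phi\,dy\,dx$ for $\phi\in C_c^\infty(\mathbb R^2)$. $\mathcal A_c(\mathbb R^2)=\{f\in\mathcal D'(\mathbb R^2)\mid f=\partial_{12}F\text{ for some }F\in\mathcal B_c(\overline{\mathbb R}^2)\}$; the primitive $F\in\mathcal B_c(\overline{\mathbb R}^2)$ of $f$ is unique, and $\partial_{12}G\in\mathcal A_c(\mathbb R^2)$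 for every $G\in C(\overline{\mathbb R}^2)$. For $f\in\mathcal A_c(\mathbb R^2)$ with primitive $F\in\mathcal B_c(\overline{\mathbb R}^2)$ and $[a,b]\times[c,d]\subseteq\overline{\mathbb R}^2$, the continuous primitive integral is $\int_a^b\int_c^d f=F(a,c)+F(b,d)-F(a,d)-F(b,c)$. *)

(* Defs.v *)
From HB Require Import structures.
From mathcomp Require Import all_boot all_order all_algebra.
From mathcomp Require Import all_classical all_reals all_analysis.

Set Implicit Arguments.
Unset Strict Implicit.
Unset Printing Implicit Defensive.

Import Order.TTheory GRing.Theory Num.Theory.
Import numFieldNormedType.Exports.

Local Open Scope classical_set_scope.
Local Open Scope ring_scope.

Section distributions.
Variable R : realType.
Implicit Types (g : R * R -> R) (F : \bar R * \bar R -> R).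

Definition partial1 g : R * R -> R := fun z => 'D_((1, 0) : R * R) g z.
Definition partial2 g : R * R -> R := fun z => 'D_((0, 1) : R * R) g z.

(* Iterated partial derivatives are indexed by words: [false] stands for
   partial1 and [true] for partial2, the head of the word acting last. *)
Definition iter_partial (w : seq bool) g : R * R -> R :=
  foldr (fun b h => if b then partial2 h else partial1 h) g w.

Definition smooth g : Prop := forall w : seq bool,
  [/\ continuous (iter_partial w g),
      forall z, derivable (iter_partial w g) z ((1, 0) : R * R) &
      forall z, derivable (iter_partial w g) z ((0, 1) : R * R)].

Definition tsupport g : set (R * R) := closure [set z | g z != 0].

Definition test_functions : set (R * R -> R) :=
  [set g | smooth g /\ compact (tsupport g)].

Definition test_function : Type := set_type test_functions.

Definition test_cvg (u : nat -> test_function) (phi : test_function) : Prop :=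
  (exists2 K : set (R * R), compact K &
     forall n, tsupport (set_val (u n)) `<=` K) /\
  (forall w : seq bool,
     {uniform, (fun n => iter_partial w (set_val (u n))) @ \oo -->
               iter_partial w (set_val phi)}).

(* The linear combination is given through its underlying function, which
   avoids endowing [test_function] with a vector space structure. *)
Definition functional_linear (T : test_function -> R) : Prop :=
  forall (a : R) (phi psi chi : test_function),
    (forall z, set_val chi z = a * set_val phi z + set_val psi z) ->
    T chi = a * T phi + T psi.

Definition functional_continuous (T : test_function -> R) : Prop :=
  forall (u : nat -> test_function) (phi : test_function),
    test_cvg u phi -> (fun n => T (u n)) @ \oo --> T phi.

Definition distributions : set (test_function -> R) :=
  [set T | functional_linear T /\ functional_continuous T].

Definition d12 F : test_function -> R := fun phi =>
  \int[lebesgue_measure]_x (\int[lebesgue_measure]_y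
    (F (x%:E, y%:E) * partial1 (partial2 (set_val phi)) (x, y))).

Definition Cbar2 : set (\bar R * \bar R -> R) := [set F | continuous F].

Definition Bc : set (\bar R * \bar R -> R) :=
  [set F | Cbar2 F /\
           forall s : \bar R, F (-oo%E, s) = 0 /\ F (s, -oo%E) = 0].

Definition Ac : set (test_function -> R) :=
  [set f | distributions f /\ exists2 F, Bc F & f = d12 F].

(* For [f] in [Ac] this is the unique primitive in [Bc]; otherwise the
   value 0 is a convention. *)
Definition Bc_primitive (f : test_function -> R) : \bar R * \bar R -> R :=
  xget (cst 0) [set F | Bc F /\ f = d12 F].

Definition cpintegral (a b c d : \bar R) (f : test_function -> R) : R :=
  let F := Bc_primitive f in F (a, c) + F (b, d) - F (a, d) - F (b, c).

End distributions.

(* Main.v *)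
Require Import Defs.
From HB Require Import structures.
From mathcomp Require Import all_boot all_order all_algebra.
From mathcomp Require Import all_classical all_reals all_analysis.
From mathcomp Require Import ring lra.

(** Part (a) is a matter of uniqueness.  If [f = d12 F] with [F] in [Bc], and
[F] is the only such function, then [Bc_primitive f] is [F]; three of the four
corner values in the definition of the integral vanish, so that [Phi = F].

For part (b), the function [corner_increment G], which maps [(x, y)] to
[G (-oo, -oo) + G (x, y) - G (-oo, y) - G (x, -oo)], belongs to [Bc] and
differs from [G] by functions of one variable, which the mixed derivative
kills ([d12_corner_increment]).  By uniqueness again it is the primitive of
[d12 G], and its value at [(x, y)] is the integral.

So the proof rests on two facts about the pairing of a continuous function [K]
on the plane with the mixed derivative of a test function [phi].

- A function of one variable pairs to zero ([pairing_fst_eq0] and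
  [pairing_snd_eq0]).  In both cases one differentiates under the integral
  sign: with [I x] the integral over [y] of [c y * d2 phi (x, y)], the inner
  integral of the pairing is [I' x].  The integral of [I'] over the line is
  zero as [I] has compact support; when [c = 1] already [I] is zero, so that a
  function of [x] can be put in front of [I'].

- If [K] pairs to zero with every test function, then
  [K (x, y) - K (x', y) = K (x, y') - K (x', y')] for all reals
  ([pairing_eq0_rect]).  On products [f x * g y] this is the lemma of du
  Bois-Reymond ([du_bois_reymond]) applied in each variable in turn.

Applied to the difference [D] of two functions in [Bc] with the same image
under [d12], the second fact extends by continuity to the compactified plane,
where [x' = y' = -oo] gives [D = 0] ([d12_inj]).

The lemma of du Bois-Reymond says that a continuous [k] which integrates to
zero against every derivative of a test function is constant.  If [k c < k b],
take a test function whose derivative is [alpha * bump b - beta * bump c],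
where the weights make the integral zero and the bumps are so narrow that [k]
stays above the mean [m] of [k b] and [k c] on the first one and below [m] on
the second; then [k - m] times the derivative is nonnegative and nonzero, yet
has integral zero.  The bumps are products of two affine substitutions in
[exp (- 1 / x)], extended by zero to [x <= 0]. *)

Set Implicit Arguments.
Unset Strict Implicit.
Unset Printing Implicit Defensive.

Import Order.TTheory GRing.Theory Num.Theory.
Import numFieldNormedType.Exports.

Local Open Scope classical_set_scope.
Local Open Scope ring_scope.

(** * Compactly supported functions of one variable *)

Definition vanishes_beyond (R : realType) (M : R) (f : R -> R) : Prop :=
  forall x, M < `|x| -> f x = 0.

Section compactly_supported.
Variables (R : realType) (M : R).
Implicit Types f g : R -> R.
Notation mu := (@lebesgue_measure R).

Lemma vanishes_restrict f : vanishes_beyond M f -> f = f \_ `[- M, M].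
Proof.
move=> f0; apply/funext => x; rewrite patchE; case: ifPn => //.
rewrite notin_setE /= in_itv /= -ler_norml => /negP.
by rewrite -ltNge => /f0.
Qed.

Lemma compact_support_integrable f :
  continuous f -> vanishes_beyond M f -> mu.-integrable setT (EFin \o f).
Proof.
move=> cf /vanishes_restrict ->.
rewrite -restrict_EFin; apply/integrable_restrict => //.
rewrite setTI; apply: continuous_compact_integrable; first exact: segment_compact.
exact: continuous_subspaceT.
Qed.

Lemma near_vanishes f x : vanishes_beyond M f -> M < `|x| ->
  {near x, f =1 cst 0}.
Proof.
move=> f0 Mx.
suff : \forall y \near x, M < `|y|.
  move=> H; apply: filterS H => y; exact: f0.
have cn : continuous (fun y : R => `|y|) by exact: norm_continuous.
by move/cvgr_gt : (cn x); exact.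
Qed.

Lemma vanishes_derive f : vanishes_beyond M f -> vanishes_beyond M (derive1 f).
Proof.
move=> f0 x Mx; rewrite derive1E.
rewrite (@near_eq_derive _ _ _ _ (cst 0)) //; last exact: near_vanishes.
by rewrite derive_cst.
Qed.

Lemma Rintegral_derive_vanishes f : (forall x, derivable f x 1) ->
  continuous (derive1 f) -> vanishes_beyond M f -> \int[mu]_x derive1 f x = 0.
Proof.
move=> df cf' f0.
pose N := `|M| + 1.
have N0 : 0 < N by rewrite /N ltr_wpDl.
have MN : M < N by rewrite /N (le_lt_trans (ler_norm _))// ltrDl.
have f'0 := vanishes_derive f0.
have -> : (derive1 f) = (derive1 f) \_ `[- N, N].
  apply/funext => x; rewrite patchE; case: ifPn => //.
  rewrite notin_setE /= in_itv /= -ler_norml => /negP.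
  by rewrite -ltNge => Nx; rewrite f'0// (lt_trans MN).
rewrite -Rintegral_mkcond /Rintegral (@continuous_FTC2 _ _ f).
- by rewrite !f0 ?normrN ?gtr0_norm// subee.
- lra.
- exact: continuous_subspaceT.
- split => //.
  + apply: cvg_at_right_filter; apply: differentiable_continuous.
    exact/derivable1_diffP.
  + apply: cvg_at_left_filter; apply: differentiable_continuous.
    exact/derivable1_diffP.
- by [].
Qed.

(** Continuity bounds [f] below by [f x0 / 2] on an interval around [x0], hence
the integral by a positive multiple of the length of that interval. *)
Lemma Rintegral_gt0 f x0 : continuous f -> vanishes_beyond M f ->
  (forall x, 0 <= f x) -> 0 < f x0 -> 0 < \int[mu]_x f x.
Proof.
move=> cf fM f0 fx0.
have [e e0 ef] : exists2 e : R, 0 < e & forall y, `|x0 - y| <= e -> f x0 / 2 <= f y.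
  have : \forall y \near x0, f x0 / 2 < f y.
    by move/cvgr_gt : (cf x0); apply; lra.
  move=> /nbhs_ballP[e /= e0 ef]; exists (e / 2); first by lra.
  by move=> y ye; apply/ltW/ef; rewrite /ball /= (le_lt_trans ye)//; lra.
pose A := [set` `[x0 - e, x0 + e]].
have mA : measurable A by exact: measurable_itv.
have muA : mu A = (e *+ 2)%:E.
  rewrite lebesgue_measure_itv /= lte_fin ifT; last lra.
  by rewrite -EFinB; congr EFin; lra.
have intc : mu.-integrable setT (EFin \o (cst (f x0 / 2) \_ A)).
  rewrite -restrict_EFin; apply/integrable_restrict => //.
  rewrite setTI; apply: continuous_compact_integrable; first exact: segment_compact.
  by apply: continuous_subspaceT => x; exact: cvg_cst.
apply: (@lt_le_trans _ _ (\int[mu]_x (cst (f x0 / 2) \_ A) x)).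
  rewrite -Rintegral_mkcond Rintegral_cst// [X in fine X]muA /= mulr_gt0//; lra.
apply: le_Rintegral => //; first exact: compact_support_integrable.
move=> x _; rewrite patchE; case: ifPn => // /set_mem; rewrite /A /= in_itv /= => xA.
by apply: ef; rewrite ler_norml; lra.
Qed.

End compactly_supported.

(** * Smooth functions of one variable and the lemma of du Bois-Reymond *)

Section smooth_functions.
Variable R : realType.
Implicit Types f g : R -> R.
Notation mu := (@lebesgue_measure R).

(** [smooth1] unfolds the successive derivatives one at a time, so that closure
under sums, products and affine substitutions follows by induction on the
order. *)
Fixpoint derivable_upto (n : nat) f : Prop :=
  if n is n'.+1 then (forall x, derivable f x 1) /\ derivable_upto n' (derive1 f)
  else True.

Definition smooth1 f : Prop := forall n, derivable_upto n f.

Lemma smooth1_derivable f x : smooth1 f -> derivable f x 1.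
Proof. by move=> /(_ 1%N)[+ _]; exact. Qed.

Lemma derivable_continuous f : (forall x, derivable f x 1) -> continuous f.
Proof. by move=> df x; apply/differentiable_continuous/derivable1_diffP. Qed.

Lemma smooth1_continuous f : smooth1 f -> continuous f.
Proof. by move=> sf; apply: derivable_continuous => x; exact: smooth1_derivable. Qed.

Lemma smooth1_derive f : smooth1 f -> smooth1 (derive1 f).
Proof. by move=> sf n; have [] := sf n.+1. Qed.

Lemma smooth1_primitive f : (forall x, derivable f x 1) ->
  smooth1 (derive1 f) -> smooth1 f.
Proof. by move=> df sf [|n]//=; split. Qed.

Lemma derivable_uptoW n f : derivable_upto n.+1 f -> derivable_upto n f.
Proof. by elim: n f => [//|n IH] f [df /IH]. Qed.

Lemma derivable_uptoD n f g :
  derivable_upto n f -> derivable_upto n g -> derivable_upto n (f \+ g).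
Proof.
elim: n f g => [//|n IH] f g [df sf] [dg sg]; split.
  by move=> x; exact: derivableD.
rewrite [X in derivable_upto _ X](_ : _ = derive1 f \+ derive1 g); first exact: IH.
by apply/funext => x; rewrite /= !derive1E deriveD.
Qed.

Lemma derivable_uptoM n f g :
  derivable_upto n f -> derivable_upto n g -> derivable_upto n (f \* g).
Proof.
elim: n f g => [//|n IH] f g Hf Hg; have [df sf] := Hf; have [dg sg] := Hg.
split; first by move=> x; exact: derivableM.
rewrite [X in derivable_upto _ X](_ : _ =
   (f \* derive1 g) \+ (g \* derive1 f)); last first.
  by apply/funext => x; rewrite /= !derive1E deriveM.
by apply: derivable_uptoD; apply: IH => //; exact: derivable_uptoW.
Qed.

Lemma derivable_upto_cst n (c : R) : derivable_upto n (cst c).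
Proof.
elim: n c => [//|n IH] c; split; first by move=> x; exact: derivable_cst.
rewrite [X in derivable_upto _ X](_ : _ = cst 0); first exact: IH.
by apply/funext => x; rewrite derive1_cst.
Qed.

Lemma is_derive_comp_affine f (a b x : R) : derivable f (a * x + b) 1 ->
  is_derive x 1 (fun t => f (a * t + b)) (a * derive1 f (a * x + b)).
Proof.
move=> df.
have da : is_derive x 1 (fun t => a * t + b) a.
  by apply: is_derive_eq; rewrite /GRing.scale /= mulr1 addr0.
have dfx : is_derive (a * x + b) 1 f (derive1 f (a * x + b)).
  by rewrite derive1E; exact: derivableP.
rewrite mulrC; exact: (@is_derive1_comp _ f (fun t => a * t + b)).
Qed.

Lemma derivable_upto_comp_affine n f (a b : R) :
  derivable_upto n f -> derivable_upto n (fun t => f (a * t + b)).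
Proof.
elim: n f => [//|n IH] f [df sf]; split.
  by move=> x; have [] := is_derive_comp_affine (df (a * x + b)).
rewrite [X in derivable_upto _ X](_ : _ =
   cst a \* (fun t => derive1 f (a * t + b))); last first.
  apply/funext => x; rewrite /= derive1E.
  by have [_ ->] := is_derive_comp_affine (df (a * x + b)).
by apply: derivable_uptoM; [exact: derivable_upto_cst|exact: IH].
Qed.

(** The family over [m] is closed under differentiation up to linear
combinations, which yields the smoothness of all its members at once. *)
Definition flat (m : nat) (x : R) : R :=
  if 0 < x then x^-1 ^+ m * expR (- x^-1) else 0.

Lemma flat_ge0 m x : 0 <= flat m x.
Proof.
by rewrite /flat; case: ifPn => // x0; rewrite mulr_ge0 ?expR_ge0// exprn_ge0//
  invr_ge0 ltW.
Qed.

Lemma flat_gt0 m x : 0 < x -> 0 < flat m x.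
Proof. by move=> x0; rewrite /flat x0 mulr_gt0 ?expR_gt0// exprn_gt0// invr_gt0. Qed.

(** This is [u ^ m.+1 / m.+1`! <= exp u] at [u = 1 / x].  A linear bound is
what the derivative at [0] requires. *)
Lemma flat_le m x : flat m x <= (m.+1)`!%:R * `|x|.
Proof.
rewrite /flat; case: ifPn => x0; last by rewrite mulr_ge0.
rewrite gtr0_norm// expRN ler_pdivrMr ?expR_gt0//.
have -> : x^-1 ^+ m = x^-1 ^+ m.+1 * x by rewrite exprSr mulfVK// gt_eqF.
rewrite mulrAC ler_pM2r// -ler_pdivrMl ?ltr0n ?fact_gt0//.
have /(expR_ge1Dxn m) : 0 <= x^-1 by rewrite invr_ge0 ltW.
by apply: le_trans; rewrite mulrC lerDr.
Qed.

Lemma cvg_flat0 m : flat m x @[x --> (0:R)] --> (0 : R).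
Proof.
have H : (m.+1)`!%:R * `|x| @[x --> (0:R)] --> (0 : R).
  rewrite [X in _ --> X](_ : _ = (m.+1)`!%:R * `|0 : R|); last by rewrite normr0 mulr0.
  by apply: cvgM; [exact: cvg_cst|exact: norm_continuous].
apply: (@squeeze_cvgr _ _ _ _ (cst 0) _ _ _ _ _ H) => //; last exact: cvg_cst.
by apply: nearW => x; rewrite flat_ge0 flat_le.
Qed.

(** At [0] the difference quotient of [flat m] is [flat m.+1], which tends to [0]. *)
Lemma is_derive_flat m (x : R) :
  is_derive x 1 (flat m) (- m%:R * flat m.+1 x + flat m.+2 x).
Proof.
have [x0|x0|->] := ltgtP x 0.
- have -> : - m%:R * flat m.+1 x + flat m.+2 x = 0.
    by rewrite /flat ltNge (ltW x0) /= mulr0 addr0.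
  apply: (@near_eq_is_derive _ _ _ (cst 0)).
  have : \forall y \near x, y < 0 by exact: lt_nbhsl.
  by apply: filterS => y y0; rewrite /flat ltNge (ltW y0).
- have di : is_derive x 1 (fun y : R => y^-1) (- x ^- 2).
    have := @is_deriveV _ id x 1 1 (lt0r_neq0 x0) _.
    by rewrite /GRing.scale /= mulr1; apply; exact: is_derive_id.
  have dX : is_derive x 1 (fun y : R => y^-1 ^+ m) (- m%:R * x^-1 ^+ m.+1).
    rewrite (_ : (fun y : R => y^-1 ^+ m) = (fun y : R => y^-1) ^+ m); last first.
      by apply/funext => y; rewrite exprfctE.
    apply: (is_derive_eq (is_deriveX m di)).
    case: (m) => [|k]; first by rewrite !mul0r oppr0 mul0r scale0r.
    by rewrite /GRing.scale /= mulrN mulNr -exprVn -mulrA -exprD addn2.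
  have dE : is_derive x 1 (fun y : R => expR (- y^-1)) (expR (- x^-1) * x^-1 ^+ 2).
    have dN : is_derive x 1 (fun y : R => - y^-1) (x^-1 ^+ 2).
      by rewrite -[x^-1 ^+ 2]opprK exprVn; exact: is_deriveN.
    exact: (@is_derive1_comp _ expR (fun y => - y^-1)).
  have nE : \forall y \near x, y^-1 ^+ m * expR (- y^-1) = flat m y.
    have : \forall y \near x, 0 < y by exact: lt_nbhsr.
    by apply: filterS => y y0; rewrite /flat y0.
  apply: (is_derive_eq (near_eq_is_derive nE (is_deriveM dX dE))).
  by rewrite /flat x0 /GRing.scale /= !exprS; ring.
- have C : h^-1 *: (flat m (h *: 1 + 0) - flat m 0) @[h --> 0^'] --> (0 : R).
    have : flat m.+1 h @[h --> 0^'] --> (0 : R).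
      apply: cvg_trans (@cvg_flat0 m.+1); exact: cvg_within_filter.
    apply: cvg_trans; apply: near_eq_cvg; near=> h.
    rewrite /flat ltxx subr0 /GRing.scale /= mulr1 addr0.
    by case: ifP => h0; rewrite ?mulr0// exprS mulrA.
  have -> : - m%:R * flat m.+1 0 + flat m.+2 0 = 0.
    by rewrite /flat ltxx mulr0 addr0.
  by split; [exact: cvgP C|exact: cvg_lim C].
Unshelve. all: by end_near. Qed.

Lemma flat_derivable_upto n m : derivable_upto n (flat m).
Proof.
elim: n m => [//|n IH] m; split.
  by move=> x; have [] := is_derive_flat m x.
rewrite [X in derivable_upto _ X](_ : _ =
    (cst (- m%:R) \* flat m.+1) \+ flat m.+2); last first.
  by apply/funext => x; rewrite derive1E; have [_ ->] := is_derive_flat m x.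
apply: derivable_uptoD; last exact: IH.
by apply: derivable_uptoM; [exact: derivable_upto_cst|exact: IH].
Qed.

Definition bump (c e x : R) : R := flat 0 (x - c + e) * flat 0 (c + e - x).

Lemma bump_smooth1 c e : smooth1 (bump c e).
Proof.
move=> n; rewrite (_ : bump c e = (fun x => flat 0 (1 * x + (e - c))) \*
                             (fun x => flat 0 (-1 * x + (c + e)))); last first.
  apply/funext => x; rewrite /bump /=; congr (flat _ _ * flat _ _); ring.
by apply: derivable_uptoM; apply: derivable_upto_comp_affine;
  exact: flat_derivable_upto.
Qed.

Lemma bump_ge0 c e x : 0 <= bump c e x.
Proof. by rewrite mulr_ge0// flat_ge0. Qed.

Lemma bump_gt0 c e : 0 < e -> 0 < bump c e c.
Proof. by move=> e0; rewrite mulr_gt0// flat_gt0; lra. Qed.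

Lemma bump_eq0 c e x : e <= `|x - c| -> bump c e x = 0.
Proof.
rewrite ler_normr /bump /flat => /orP[ex|ex].
  by rewrite [X in _ * X]ifF ?mulr0//; apply/negbTE; rewrite -leNgt; lra.
by rewrite ifF ?mul0r//; apply/negbTE; rewrite -leNgt; lra.
Qed.

Lemma bump_vanishes c e : vanishes_beyond (`|c| + e) (bump c e).
Proof.
move=> x xM; apply: bump_eq0.
by rewrite (le_trans _ (lerB_dist _ _))//; lra.
Qed.

(** The primitive is the integral from [-oo]; to the right of the support it
equals the total integral of [g], which is why that integral must be zero. *)
Lemma compact_support_primitive M g : continuous g -> vanishes_beyond M g ->
  \int[mu]_x g x = 0 ->
  exists G : R -> R, (forall x : R, is_derive x 1 G (g x)) /\ vanishes_beyond M G.
Proof.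
move=> cg g0 intg; have ig := compact_support_integrable cg g0.
pose G x := (\int[mu]_(t in [set` `]-oo, x]]) g t).
exists G; split=> [x|x Mx].
  have := @continuous_FTC1 R g -oo%O x (x + 1) _ _ _ (cg x).
  case=> [|||dG <-]; first by rewrite ltrDl.
  - by apply: (integrableS _ _ _ ig).
  - exact: ltNyr.
  by rewrite -/G derive1E; exact: derivableP.
rewrite /G Rintegral_mkcond; have [x0|x0] := ltP x 0.
  rewrite (_ : _ \_ _ = cst 0) ?Rintegral_cst ?mul0r//.
  apply/funext => t; rewrite patchE; case: ifPn => // /set_mem /=.
  rewrite in_itv /= => tx; apply: g0; rewrite (lt_le_trans Mx)//.
  by rewrite !ltr0_norm; lra.
rewrite (_ : _ \_ _ = g)//.
apply/funext => t; rewrite patchE; case: ifPn => // /negP.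
rewrite inE /= in_itv /= => /negP; rewrite -ltNge => tx; rewrite g0//.
by rewrite (lt_trans Mx)// !ger0_norm; lra.
Qed.

Lemma vanishes_beyondW (M N : R) f : M <= N ->
  vanishes_beyond M f -> vanishes_beyond N f.
Proof. by move=> MN f0 x Nx; rewrite f0// (le_lt_trans MN). Qed.

(** Weighting each bump by the integral of the other makes the total integral
zero, whence a compactly supported primitive. *)
Lemma exists_test_derivative (b c e : R) : 0 < e ->
  exists (M alpha beta : R) (phi : R -> R),
   [/\ smooth1 phi, vanishes_beyond M phi, 0 < alpha, 0 < beta &
   forall x, derive1 phi x = alpha * bump b e x - beta * bump c e x].
Proof.
move=> e0.
pose M := Num.max (`|b| + e) (`|c| + e).
have cb := smooth1_continuous (bump_smooth1 b e).
have cc := smooth1_continuous (bump_smooth1 c e).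
have vb : vanishes_beyond M (bump b e).
  by apply: vanishes_beyondW (@bump_vanishes b e); rewrite le_max lexx.
have vc : vanishes_beyond M (bump c e).
  by apply: vanishes_beyondW (@bump_vanishes c e); rewrite le_max lexx orbT.
pose alpha := \int[mu]_x bump c e x.
pose beta := \int[mu]_x bump b e x.
have alpha0 : 0 < alpha.
  by apply: (Rintegral_gt0 cc vc _ (bump_gt0 c e0)) => x; exact: bump_ge0.
have beta0 : 0 < beta.
  by apply: (Rintegral_gt0 cb vb _ (bump_gt0 b e0)) => x; exact: bump_ge0.
pose g := (cst alpha \* bump b e) \+ (cst (- beta) \* bump c e).
have sg : smooth1 g.
  by move=> n; apply: derivable_uptoD; apply: derivable_uptoM;
    first [exact: derivable_upto_cst|exact: bump_smooth1].
have vg : vanishes_beyond M g.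
  by move=> x Mx; rewrite /g /= vb// vc// !mulr0 addr0.
have [|phi [dphi vphi]] := compact_support_primitive (smooth1_continuous sg) vg.
  have ib := compact_support_integrable cb vb.
  have ic := compact_support_integrable cc vc.
  rewrite (_ : g = fun x => alpha * bump b e x - beta * bump c e x); last first.
    by apply/funext => x; rewrite /g /= mulNr.
  rewrite RintegralB//; last 2 first.
  - exact: (@integrableZl _ _ _ _ _ _ alpha _ ib).
  - exact: (@integrableZl _ _ _ _ _ _ beta _ ic).
  by rewrite !RintegralZl// mulrC subrr.
have dg : derive1 phi = g.
  by apply/funext => x; rewrite derive1E; have [_ ->] := dphi x.
exists M, alpha, beta, phi; split; [|exact: vphi|exact: alpha0|exact: beta0|].
  by apply: smooth1_primitive; [move=> x; have [] := dphi x|rewrite dg].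
by move=> x; rewrite dg /g /= mulNr.
Qed.

(** A derivative made of a positive bump around [b] and a negative one around
[c] detects the difference between [k b] and [k c]. *)
Lemma du_bois_reymond (k : R -> R) : continuous k ->
  (forall M phi, smooth1 phi -> vanishes_beyond M phi ->
    \int[mu]_x (k x * derive1 phi x) = 0) ->
  forall b c, k b = k c.
Proof.
move=> ck k0 b c; wlog kbc : b c / k c < k b.
  by move=> H; have [/H ->|/H ->|] := ltgtP (k b) (k c).
exfalso.
pose m := (k b + k c) / 2.
have [e e0 [eb ec]] : exists2 e : R, 0 < e &
    (forall t, `|t - b| < e -> m < k t) /\ (forall t, `|t - c| < e -> k t < m).
  have nb : \forall y \near b, m < k y.
    by move/cvgr_gt : (ck b); apply; rewrite /m; lra.
  have nc : \forall y \near c, k y < m.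
    by move/cvgr_lt : (ck c); apply; rewrite /m; lra.
  have [e1 /= e10 H1] := (nbhs_ballP _ _).1 nb.
  have [e2 /= e20 H2] := (nbhs_ballP _ _).1 nc.
  exists (Num.min e1 e2); first by rewrite lt_min e10.
  split=> t; rewrite lt_min distrC => /andP[? ?]; [exact: H1|exact: H2].
have [M [alpha [beta [phi [sphi vphi alpha0 beta0 dphi]]]]] :=
  exists_test_derivative b c e0.
have sphi' := smooth1_derive sphi.
have cphi' := smooth1_continuous sphi'.
have vphi' := vanishes_derive vphi.
(* Subtracting m does not change the integral, since that of a derivative with
   compact support is zero, and it makes both terms of wE nonnegative. *)
pose w x := (k x - m) * derive1 phi x.
have cw : continuous w.
  by move=> x; apply: cvgM; [apply: cvgB; [exact: ck|exact: cvg_cst]|exact: cphi'].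
have vw : vanishes_beyond M w by move=> x Mx; rewrite /w vphi' ?mulr0.
have wE x : w x = alpha * ((k x - m) * bump b e x) + beta * ((m - k x) * bump c e x).
  by rewrite /w dphi; ring.
have wb x : 0 <= (k x - m) * bump b e x.
  have [xb|xb] := ltP `|x - b| e; last by rewrite bump_eq0// mulr0.
  by rewrite mulr_ge0 ?bump_ge0// subr_ge0 ltW// eb.
have wc x : 0 <= (m - k x) * bump c e x.
  have [xc|xc] := ltP `|x - c| e; last by rewrite bump_eq0// mulr0.
  by rewrite mulr_ge0 ?bump_ge0// subr_ge0 ltW// ec.
have : 0 < \int[mu]_x w x.
  apply: (Rintegral_gt0 cw vw (x0 := b)) => [x|].
    by rewrite wE addr_ge0// mulr_ge0// ltW.
  rewrite wE; apply: ltr_wpDr; first by rewrite mulr_ge0// ltW.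
  rewrite mulr_gt0// mulr_gt0 ?bump_gt0//.
  by rewrite subr_gt0 eb// subrr normr0.
rewrite (_ : w = fun x => k x * derive1 phi x - m * derive1 phi x); last first.
  by apply/funext => x; rewrite /w mulrBl.
have iphi' := compact_support_integrable cphi' vphi'.
rewrite RintegralB//; last 2 first.
- apply: (@compact_support_integrable _ M).
    by move=> x; apply: cvgM; [exact: ck|exact: cphi'].
  by move=> x Mx; rewrite vphi' ?mulr0.
- exact: (@integrableZl _ _ _ _ _ _ m _ iphi').
rewrite (k0 M)// RintegralZl// (Rintegral_derive_vanishes _ cphi' vphi).
  by rewrite mulr0 subrr ltxx.
by move=> x; exact: smooth1_derivable.
Qed.

End smooth_functions.

(** * Partial derivatives and integrals with a parameter *)

Section plane.
Variable R : realType.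
Implicit Types (g L : R * R -> R) (M : R).
Notation mu := (@lebesgue_measure R).

Definition vanishes_beyond2 M g : Prop :=
  forall x y, M < `|x| \/ M < `|y| -> g (x, y) = 0.

(** The increments of [g] along a coordinate axis are those of a section of
[g], so the partial derivatives are derivatives of functions of one variable. *)
Lemma derive_quotient_fst g (x y : R) :
  (fun h => h^-1 *: ((g \o shift (x, y)) (h *: ((1, 0) : R * R)) - g (x, y))) =
  (fun h => h^-1 *: (((fun t => g (t, y)) \o shift x) (h *: (1 : R)) - g (x, y))).
Proof.
by apply/funext => h /=; congr (_ *: (g (_, _) - _)); rewrite /= scaler0 add0r.
Qed.

Lemma derive_quotient_snd g (x y : R) :
  (fun h => h^-1 *: ((g \o shift (x, y)) (h *: ((0, 1) : R * R)) - g (x, y))) =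
  (fun h => h^-1 *: (((fun t => g (x, t)) \o shift y) (h *: (1 : R)) - g (x, y))).
Proof.
by apply/funext => h /=; congr (_ *: (g (_, _) - _)); rewrite /= scaler0 add0r.
Qed.

Lemma partial1E g x y : partial1 g (x, y) = derive1 (fun t => g (t, y)) x.
Proof. by rewrite derive1E /partial1 /derive derive_quotient_fst. Qed.

Lemma partial2E g x y : partial2 g (x, y) = derive1 (fun t => g (x, t)) y.
Proof. by rewrite derive1E /partial2 /derive derive_quotient_snd. Qed.

Lemma derivable_fstE g x y :
  derivable g (x, y) ((1, 0) : R * R) = derivable (fun t => g (t, y)) x 1.
Proof. by rewrite /derivable derive_quotient_fst. Qed.

Lemma derivable_sndE g x y :
  derivable g (x, y) ((0, 1) : R * R) = derivable (fun t => g (x, t)) y 1.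
Proof. by rewrite /derivable derive_quotient_snd. Qed.

Lemma partial1_vanishes M g :
  vanishes_beyond2 M g -> vanishes_beyond2 M (partial1 g).
Proof.
move=> g0 x y xy; rewrite partial1E.
have [My|My] := ltP M `|y|.
  rewrite (_ : (fun t => g (t, y)) = cst 0) ?derive1_cst//.
  by apply/funext => t; rewrite g0//; right.
case: xy => [Mx|]; last by rewrite ltNge My.
by rewrite (vanishes_derive _ Mx)// => t Mt; rewrite g0//; left.
Qed.

Lemma partial2_vanishes M g :
  vanishes_beyond2 M g -> vanishes_beyond2 M (partial2 g).
Proof.
move=> g0 x y xy; rewrite partial2E.
have [Mx|Mx] := ltP M `|x|.
  rewrite (_ : (fun t => g (x, t)) = cst 0) ?derive1_cst//.
  by apply/funext => t; rewrite g0//; left.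
case: xy => [|My]; first by rewrite ltNge Mx.
by rewrite (vanishes_derive _ My)// => t Mt; rewrite g0//; right.
Qed.

Lemma compact_support_vanishes g : compact (tsupport g) ->
  exists M, vanishes_beyond2 M g.
Proof.
move=> /compact_bounded /ex_strict_bound_gt0[M _ /= HM]; exists M => x y xy.
apply/eqP/negPn/negP => gxy.
have : `|(x, y)| < M by apply: HM; exact: subset_closure.
rewrite prod_normE /= gt_max => /andP[xM yM].
by case: xy; rewrite ltNge ltW.
Qed.

Section sections.
Context {T U V : topologicalType}.
Implicit Type f : T * U -> V.

Lemma continuous_section1 f u : continuous f -> continuous (fun t => f (t, u)).
Proof.
move=> cf t; apply: (@continuous_comp _ _ _ (fun t => (t, u)) f); last exact: cf.
by apply: cvg_pair; [exact: cvg_id|exact: cvg_cst].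
Qed.

Lemma continuous_section2 f t : continuous f -> continuous (fun u => f (t, u)).
Proof.
move=> cf u; apply: (@continuous_comp _ _ _ (fun u => (t, u)) f); last exact: cf.
by apply: cvg_pair; [exact: cvg_cst|exact: cvg_id].
Qed.

Lemma continuous_comp_fst (h : T -> V) : continuous h ->
  continuous (fun z : T * U => h z.1).
Proof.
by move=> ch z; apply: (@continuous_comp _ _ _ fst h); [exact: cvg_fst|exact: ch].
Qed.

Lemma continuous_comp_snd (h : U -> V) : continuous h ->
  continuous (fun z : T * U => h z.2).
Proof.
by move=> ch z; apply: (@continuous_comp _ _ _ snd h); [exact: cvg_snd|exact: ch].
Qed.

End sections.

Lemma continuousM2 (T : topologicalType) (f g : T -> R) :
  continuous f -> continuous g -> continuous (fun t => f t * g t).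
Proof. by move=> cf cg t; apply: cvgM; [exact: cf|exact: cg]. Qed.

(** [L] is bounded on the compact rectangle on which [x] stays within [1] of
[a] and [y] within the support; this bound, cut off outside the support, is the
dominating function that the theorems on integrals with a parameter ask for. *)
Lemma locally_dominated M L (a : R) : continuous L ->
  (forall x, vanishes_beyond M (fun y => L (x, y))) ->
  exists G : R -> R, [/\ forall y, 0 <= G y, mu.-integrable setT (EFin \o G) &
    forall x y, x \in `]a - 1, a + 1[ -> `|L (x, y)| <= G y].
Proof.
move=> cL vL.
pose A := [set` `[a - 1, a + 1]] `*` [set` `[- `|M|, `|M|]].
have A0 : A !=set0.
  exists (a, 0); split; rewrite /= in_itv /=; last by rewrite oppr_le0 normr_ge0.
  by apply/andP; split; lra.
have cA : compact A by apply: compact_setX; exact: segment_compact.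
have cnL : {within A, continuous (fun z => `|L z|)}.
  apply: continuous_subspaceT => z.
  by apply: (@continuous_comp _ _ _ L); [exact: cL|exact: norm_continuous].
have [c cA' Hc] := compact_EVT_max A0 cA cnL.
pose G : R -> R := cst `|L c| \_ [set` `[- `|M|, `|M|]].
exists G; split=> [y||x y xa].
- by rewrite /G patchE; case: ifP.
- rewrite /G -restrict_EFin; apply/integrable_restrict => //.
  rewrite setTI; apply: continuous_compact_integrable; first exact: segment_compact.
  by apply: continuous_subspaceT => x; exact: cvg_cst.
- rewrite /G patchE; case: ifPn => [/set_mem yM|].
    apply: Hc; apply/mem_set; split => //=.
    by move: xa; rewrite /= !in_itv /= => /andP[? ?]; rewrite !ltW.
  rewrite notin_setE /= in_itv /= -ler_norml => /negP; rewrite -ltNge => yM.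
  by rewrite vL ?normr0// (le_lt_trans (ler_norm _)).
Qed.

Lemma parametric_integrable M L x : continuous L ->
  (forall x, vanishes_beyond M (fun y => L (x, y))) ->
  mu.-integrable setT (EFin \o (fun y => L (x, y))).
Proof.
move=> cL vL; apply: (compact_support_integrable _ (vL x)).
exact: continuous_section2.
Qed.

Lemma parametric_continuous M L : continuous L ->
  (forall x, vanishes_beyond M (fun y => L (x, y))) ->
  continuous (fun x => \int[mu]_y L (x, y)).
Proof.
move=> cL vL a; have [G [G0 iG LG]] := locally_dominated a cL vL.
apply: (@continuity_under_integral _ _ _ mu (fun x y => L (x, y)) setT measurableT
  (a - 1) (a + 1) _ _ G) => //.
- by move=> x _; exact: parametric_integrable vL.
- by apply/aeW => y _ x _; exact: continuous_section1.
- by move=> x xa; apply/aeW => y _; exact: LG.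
- by rewrite inE /= in_itv /=; apply/andP; split; lra.
Qed.

Lemma parametric_derive M L : continuous L -> continuous (partial1 L) ->
  (forall z, derivable L z ((1, 0) : R * R)) ->
  (forall x, vanishes_beyond M (fun y => L (x, y))) ->
  (forall x, vanishes_beyond M (fun y => partial1 L (x, y))) ->
  forall a : R, is_derive a 1 (fun x => \int[mu]_y L (x, y))
    (\int[mu]_y partial1 L (a, y)).
Proof.
move=> cL cL1 dL vL vL1 a; have [G [G0 iG LG]] := locally_dominated a cL1 vL1.
have Ia : a \in `]a - 1, a + 1[ by rewrite in_itv /=; apply/andP; split; lra.
have iL x : x \in `]a - 1, a + 1[ -> mu.-integrable setT (EFin \o (fun y => L (x, y))).
  by move=> _; exact: parametric_integrable vL.
have dL' x y : x \in `]a - 1, a + 1[ -> [set: R] y ->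
    derivable ((fun x y => L (x, y)) ^~ y) x 1.
  by move=> _ _; rewrite -derivable_fstE.
have bL x y : x \in `]a - 1, a + 1[ -> [set: R] y ->
    `|partial1of2 (fun x y => L (x, y)) x y| <= G y.
  by move=> xa _; rewrite /partial1of2 -partial1E; exact: LG.
have D := @derivable_under_integral _ _ _ mu (fun x y => L (x, y)) setT measurableT
  a (a - 1) (a + 1) Ia iL dL' G G0 iG bL.
have E := @differentiation_under_integral _ _ _ mu (fun x y => L (x, y)) setT measurableT
  a (a - 1) (a + 1) Ia iL dL' G G0 iG bL.
apply: DeriveDef; first exact: D.
by rewrite -derive1E E; apply: eq_Rintegral => y _; rewrite partial1E.
Qed.

End plane.

(** * Pairing with the mixed derivative of a test function *)

Section pairing.
Variable R : realType.
Implicit Types (K phi : R * R -> R).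
Notation mu := (@lebesgue_measure R).

Definition pairing K phi : R :=
  \int[mu]_x (\int[mu]_y (K (x, y) * partial1 (partial2 phi) (x, y))).

Lemma test_mixed_partial phi : test_functions phi ->
  [/\ continuous (partial2 phi), continuous (partial1 (partial2 phi)) &
      forall z, derivable (partial2 phi) z ((1, 0) : R * R)].
Proof.
move=> [sphi _]; have [c2 d2 _] := sphi [:: true].
by have [c12 _ _] := sphi [:: false; true]; split; [exact: c2|exact: c12|exact: d2].
Qed.

Lemma test_vanishes phi : test_functions phi -> exists M, vanishes_beyond2 M phi.
Proof. by move=> [_]; exact: compact_support_vanishes. Qed.

Lemma pairing_integrable M K phi : test_functions phi -> vanishes_beyond2 M phi ->
  continuous K ->
  [/\ forall x, mu.-integrable setT
        (EFin \o (fun y => K (x, y) * partial1 (partial2 phi) (x, y))) &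
      mu.-integrable setT (EFin \o
        (fun x => \int[mu]_y (K (x, y) * partial1 (partial2 phi) (x, y))))].
Proof.
move=> tphi vphi cK; have [_ cphi _] := test_mixed_partial tphi.
have v12 := partial1_vanishes (partial2_vanishes vphi).
have cL : continuous (fun z => K z * partial1 (partial2 phi) z).
  exact: continuousM2.
have vL x : vanishes_beyond M (fun y => K (x, y) * partial1 (partial2 phi) (x, y)).
  by move=> y My; rewrite v12 ?mulr0//; right.
split; first by move=> x; exact: (parametric_integrable x cL vL).
apply: (@compact_support_integrable _ M); first exact: (parametric_continuous cL vL).
move=> x Mx; rewrite (_ : (fun y => _) = cst 0) ?Rintegral_cst ?mul0r//.
by apply/funext => y; rewrite v12 ?mulr0//; left.
Qed.

Lemma pairingB K1 K2 phi : test_functions phi -> continuous K1 -> continuous K2 ->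
  pairing (K1 \- K2) phi = pairing K1 phi - pairing K2 phi.
Proof.
move=> tphi cK1 cK2; have [M vphi] := test_vanishes tphi.
have [i1 j1] := pairing_integrable tphi vphi cK1.
have [i2 j2] := pairing_integrable tphi vphi cK2.
rewrite /pairing -RintegralB//; apply: eq_Rintegral => x _.
by rewrite -RintegralB//; apply: eq_Rintegral => y _; rewrite /= mulrBl.
Qed.

(** The inner integral is [c x] times the derivative of the integral of
[partial2 phi] over [y], and that integral is zero for every [x]. *)
Lemma pairing_fst_eq0 (c : R -> R) phi : test_functions phi ->
  pairing (fun z => c z.1) phi = 0.
Proof.
move=> tphi; have [M vphi] := test_vanishes tphi.
have [ca ca1 da] := test_mixed_partial tphi.
have va := partial2_vanishes vphi; have va1 := partial1_vanishes va.
have I0 : (fun x => \int[mu]_y partial2 phi (x, y)) = cst 0.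
  apply/funext => x.
  have E : (fun y => partial2 phi (x, y)) = derive1 (fun y => phi (x, y)).
    by apply/funext => y; rewrite partial2E.
  rewrite E (@Rintegral_derive_vanishes _ M)//.
  - by move=> y; rewrite -derivable_sndE; have [_ _] := tphi.1 [::]; exact.
  - by rewrite -E; exact: (continuous_section2 ca).
  - by move=> y My; rewrite vphi//; right.
have vx x : vanishes_beyond M (fun y => partial2 phi (x, y)).
  by move=> y My; rewrite va//; right.
have vx1 x : vanishes_beyond M (fun y => partial1 (partial2 phi) (x, y)).
  by move=> y My; rewrite va1//; right.
rewrite /pairing (_ : (fun x => _) = cst 0) ?Rintegral_cst ?mul0r//.
apply/funext => x /=; rewrite RintegralZl//; last exact: parametric_integrable vx1.
have [_] := parametric_derive ca ca1 da vx vx1 x.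
by rewrite I0 derive_cst => <-; rewrite mulr0.
Qed.

(** The inner integral is the derivative of a compactly supported function
of [x], namely the integral of [c y * partial2 phi (x, y)] over [y]. *)
Lemma pairing_snd_eq0 (c : R -> R) phi : test_functions phi -> continuous c ->
  pairing (fun z => c z.2) phi = 0.
Proof.
move=> tphi cc; have [M vphi] := test_vanishes tphi.
have [ca ca1 da] := test_mixed_partial tphi.
have va := partial2_vanishes vphi; have va1 := partial1_vanishes va.
pose L z := c z.2 * partial2 phi z.
have dL (x y : R) : is_derive x 1 (fun t => L (t, y))
    (c y * partial1 (partial2 phi) (x, y)).
  rewrite partial1E derive1E.
  have Da : is_derive x 1 (fun t => partial2 phi (t, y))
      ('D_1 (fun t => partial2 phi (t, y)) x).
    by apply: derivableP; rewrite -derivable_fstE.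
  exact: (is_deriveZ (c y) Da).
have L1 : partial1 L = (fun z => c z.2 * partial1 (partial2 phi) z).
  by apply/funext => -[x y]; rewrite partial1E derive1E; have [_ ->] := dL x y.
have cc2 : continuous (fun z : R * R => c z.2) by exact: continuous_comp_snd.
have cL : continuous L := continuousM2 cc2 ca.
have cL1 : continuous (partial1 L) by rewrite L1; exact: (continuousM2 cc2 ca1).
have vL x : vanishes_beyond M (fun y => L (x, y)).
  by move=> y My; rewrite /L va ?mulr0//; right.
have vL1 x : vanishes_beyond M (fun y => partial1 L (x, y)).
  by move=> y My; rewrite L1 va1 ?mulr0//; right.
have dL' z : derivable L z ((1, 0) : R * R).
  by case: z => x y; rewrite derivable_fstE; have [] := dL x y.
have D := parametric_derive cL cL1 dL' vL vL1.
pose I := fun x => \int[mu]_y L (x, y).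
have dI x : derivable I x 1 by have [] := D x.
have E : derive1 I = (fun x => \int[mu]_y partial1 L (x, y)).
  by apply/funext => x; rewrite derive1E; have [_] := D x.
have cI : continuous (derive1 I) by rewrite E; exact: (parametric_continuous cL1 vL1).
have vI : vanishes_beyond M I.
  move=> x Mx; rewrite /I (_ : (fun y => _) = cst 0) ?Rintegral_cst ?mul0r//.
  by apply/funext => y; rewrite /L va ?mulr0//; left.
by have := Rintegral_derive_vanishes dI cI vI; rewrite E L1.
Qed.

Definition tensor (f g : R -> R) : R * R -> R := fun z => f z.1 * g z.2.

Lemma is_derive_tensor_fst (f g : R -> R) (x y : R) : derivable f x 1 ->
  is_derive x 1 (fun t => tensor f g (t, y)) (derive1 f x * g y).
Proof.
move=> df; rewrite derive1E mulrC; have Df := derivableP df.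
rewrite (_ : (fun t => _) = g y \*: f); first exact: (is_deriveZ (g y) Df).
by apply/funext => t; rewrite /tensor /= mulrC.
Qed.

Lemma is_derive_tensor_snd (f g : R -> R) (x y : R) : derivable g y 1 ->
  is_derive y 1 (fun t => tensor f g (x, t)) (f x * derive1 g y).
Proof.
by move=> dg; rewrite derive1E; exact: (is_deriveZ (f x) (derivableP dg)).
Qed.

Lemma partial1_tensor (f g : R -> R) : (forall x, derivable f x 1) ->
  partial1 (tensor f g) = tensor (derive1 f) g.
Proof.
move=> df; apply/funext => -[x y]; rewrite partial1E derive1E.
by have [_ ->] := is_derive_tensor_fst g y (df x).
Qed.

Lemma partial2_tensor (f g : R -> R) : (forall x, derivable g x 1) ->
  partial2 (tensor f g) = tensor f (derive1 g).
Proof.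
move=> dg; apply/funext => -[x y]; rewrite partial2E derive1E.
by have [_ ->] := is_derive_tensor_snd f x (dg y).
Qed.

Lemma iter_partial_tensor (f g : R -> R) (w : seq bool) : smooth1 f -> smooth1 g ->
  exists f' g' : R -> R,
    [/\ smooth1 f', smooth1 g' & iter_partial w (tensor f g) = tensor f' g'].
Proof.
move=> sf sg; elim: w => [|b w [f' [g' [sf' sg' E]]]]; first by exists f, g.
rewrite /= -/(iter_partial w (tensor f g)) E; case: b.
- exists f', (derive1 g'); split => //; first exact: smooth1_derive.
  by apply: partial2_tensor => x; exact: smooth1_derivable.
- exists (derive1 f'), g'; split => //; first exact: smooth1_derive.
  by apply: partial1_tensor => x; exact: smooth1_derivable.
Qed.

Lemma test_tensor (f g : R -> R) (M N : R) : smooth1 f -> smooth1 g ->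
  vanishes_beyond M f -> vanishes_beyond N g -> test_functions (tensor f g).
Proof.
move=> sf sg vf vg; split.
  move=> w; have [f' [g' [sf' sg' ->]]] := iter_partial_tensor w sf sg; split.
  - apply: continuousM2; [apply: continuous_comp_fst|apply: continuous_comp_snd];
      exact: smooth1_continuous.
  - move=> [x y]; rewrite derivable_fstE.
    by have [] := is_derive_tensor_fst g' y (smooth1_derivable (x := x) sf').
  - move=> [x y]; rewrite derivable_sndE.
    by have [] := is_derive_tensor_snd f' x (smooth1_derivable (x := y) sg').
have cA : compact ([set` `[- M, M]] `*` [set` `[- N, N]]).
  by apply: compact_setX; exact: segment_compact.
apply: (subclosed_compact _ cA); first exact: closed_closure.
have clA := compact_closed (@norm_hausdorff _ (R * R)%type) cA.
rewrite [X in _ `<=` X]((closure_id _).1 clA).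
apply: closure_subset => -[x y] /= fg0; rewrite !in_itv /= -!ler_norml.
split; rewrite leNgt; apply/negP => xM; case/negP: fg0; rewrite /tensor /=.
  by rewrite vf// mul0r.
by rewrite vg// mulr0.
Qed.

Lemma pairing_tensor K (f g : R -> R) M N : continuous K -> smooth1 f -> smooth1 g ->
  vanishes_beyond M f -> vanishes_beyond N g ->
  pairing K (tensor f g) =
  \int[mu]_x ((\int[mu]_y (K (x, y) * derive1 g y)) * derive1 f x).
Proof.
move=> cK sf sg vf vg; apply: eq_Rintegral => x _.
rewrite partial2_tensor; last by move=> y; exact: smooth1_derivable.
rewrite partial1_tensor; last by move=> y; exact: smooth1_derivable.
rewrite -RintegralZr//; first by apply: eq_Rintegral => y _; rewrite /tensor /=; ring.
apply: (@compact_support_integrable _ N).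
  apply: continuousM2; first exact: continuous_section2.
  exact/smooth1_continuous/smooth1_derive.
by move=> y Ny; rewrite (vanishes_derive vg)// mulr0.
Qed.

(** For fixed [g], pairing with products [f x * g y] shows that the integral
of [K (x, y) * g' y] over [y] does not depend on [x]; so the difference of two
sections of [K] integrates to zero against every [g']. *)
Lemma pairing_eq0_rect K : continuous K ->
  (forall phi, test_functions phi -> pairing K phi = 0) ->
  forall x x' y y', K (x, y) - K (x', y) = K (x, y') - K (x', y').
Proof.
move=> cK K0 x x'.
apply: (@du_bois_reymond _ (fun y => K (x, y) - K (x', y))).
  by move=> y; apply: cvgB; exact: continuous_section2.
move=> N g sg vg.
have cg' := smooth1_continuous (smooth1_derive sg).
have vg' := vanishes_derive vg.
pose L z := K z * derive1 g z.2.
have cL : continuous L by apply: continuousM2 => //; exact: continuous_comp_snd.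
have vL t : vanishes_beyond N (fun y => L (t, y)).
  by move=> y Ny; rewrite /L vg' ?mulr0.
have kcst : forall b c, \int[mu]_y L (b, y) = \int[mu]_y L (c, y).
  apply: (@du_bois_reymond _ (fun t => \int[mu]_y L (t, y))).
    exact: (parametric_continuous cL vL).
  move=> M f sf vf; rewrite -(pairing_tensor cK sf sg vf vg).
  exact/K0/(test_tensor sf sg vf vg).
rewrite (_ : (fun y => _) = (fun y => L (x, y) - L (x', y))); last first.
  by apply/funext => y; rewrite /L mulrBl.
rewrite RintegralB//; first by rewrite (kcst x x') subrr.
all: exact: (parametric_integrable _ cL vL).
Qed.

End pairing.

(** * The compactified plane *)

Section extended_plane.
Variable R : realType.

Lemma continuous_ereal_eq0 (k : \bar R -> R) : continuous k ->
  (forall r : R, k r%:E = 0) -> forall s, k s = 0.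
Proof.
move=> ck k0 s; apply/eqP/negPn/negP => ks.
have : \forall t \near s, k t != 0.
  apply: (ck s (fun r => r != 0)); exact: (open_nbhs_nbhs (conj (@open_neq _ _) ks)).
case: s ks => [r|_|_]; first by rewrite k0 eqxx.
- by move=> [M [_ /(_ (M + 1)%:E)]]; rewrite lte_fin ltrDl ltr01 k0 eqxx => /(_ isT).
- by move=> [M [_ /(_ (M - 1)%:E)]]; rewrite lte_fin gtrDl ltrN10 k0 eqxx => /(_ isT).
Qed.

Definition real_plane (F : \bar R * \bar R -> R) : R * R -> R :=
  fun z => F (z.1%:E, z.2%:E).

Lemma continuous_EFin : continuous (@EFin R).
Proof. by move=> r; apply: cvg_EFin; [exact: nearW|exact: cvg_id]. Qed.

Lemma continuous_real_plane F : continuous F -> continuous (real_plane F).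
Proof.
move=> cF z; apply: (@continuous_comp _ _ _ (fun z : R * R => (z.1%:E, z.2%:E)) F);
  last exact: cF.
have c1 : continuous (fun z : R * R => z.1%:E) := continuous_comp_fst continuous_EFin.
have c2 : continuous (fun z : R * R => z.2%:E) := continuous_comp_snd continuous_EFin.
exact: (cvg_pair (c1 z) (c2 z)).
Qed.

Lemma d12E (F : \bar R * \bar R -> R) (phi : test_function R) :
  d12 F phi = pairing (real_plane F) (set_val phi).
Proof. by []. Qed.

(** The difference of [F] and [H] satisfies the rectangle identity at real
points.  It extends to the compactification one variable at a time: sending
[y'] and then [x'] to [-oo] kills three of the four terms, and the remaining
value is zero first at real points, then everywhere. *)
Lemma d12_inj (F H : \bar R * \bar R -> R) : Bc F -> Bc H -> d12 F = d12 H -> F = H.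
Proof.
move=> [cF F0] [cH H0] FH.
pose D z := F z - H z.
have cD : continuous D by move=> z; apply: cvgB; [exact: cF|exact: cH].
have D0 s : D (s, -oo%E) = 0 /\ D (-oo%E, s) = 0.
  have [F1 F2] := F0 s; have [H1 H2] := H0 s.
  by rewrite /D F1 F2 H1 H2 subrr.
have rect : forall x x' y y' : R,
    D (x%:E, y%:E) - D (x'%:E, y%:E) = D (x%:E, y'%:E) - D (x'%:E, y'%:E).
  apply: (@pairing_eq0_rect _ (real_plane D)); first exact: continuous_real_plane.
  move=> phi tphi.
  rewrite (_ : real_plane D = real_plane F \- real_plane H)//.
  rewrite (pairingB tphi (continuous_real_plane cF) (continuous_real_plane cH)).
  have := congr1 (fun T => T (SigSub (mem_set tphi))) FH.
  by rewrite !d12E => ->; rewrite subrr.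
have step1 (x x' y : R) : D (x%:E, y%:E) - D (x'%:E, y%:E) = 0.
  have := @continuous_ereal_eq0 (fun s => D (x%:E, y%:E) - D (x'%:E, y%:E)
     - (D (x%:E, s) - D (x'%:E, s))) _ _ -oo%E.
  rewrite !(D0 _).1 subrr subr0; apply.
    by move=> s; apply: cvgB; [exact: cvg_cst|apply: cvgB; exact: continuous_section2].
  by move=> y'; rewrite (rect x x' y y') subrr.
have step2 (x y : R) : D (x%:E, y%:E) = 0.
  have := @continuous_ereal_eq0 (fun s => D (x%:E, y%:E) - D (s, y%:E)) _ _ -oo%E.
  rewrite (D0 _).2 subr0; apply; last by move=> x'; exact: step1.
  by move=> s; apply: cvgB; [exact: cvg_cst|exact: continuous_section1].
have step3 (s : \bar R) (y : R) : D (s, y%:E) = 0.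
  apply: (@continuous_ereal_eq0 (fun s => D (s, y%:E))) => //.
  exact: continuous_section1.
apply/funext => -[s t]; apply/eqP; rewrite -subr_eq0; apply/eqP.
apply: (@continuous_ereal_eq0 (fun t => D (s, t))) => //.
exact: continuous_section2.
Qed.

Lemma Bc_primitiveP (f : test_function R -> R) F :
  Bc F -> f = d12 F -> Bc_primitive f = F.
Proof.
move=> BF fF; rewrite /Bc_primitive.
case: xgetP => [G _ [BG fG]|/(_ F)]; last by case.
exact: (d12_inj BG BF (etrans (esym fG) fF)).
Qed.

(** The increment of [G] over the rectangle from [(-oo, -oo)] to [z]. *)
Definition corner_increment (G : \bar R * \bar R -> R) : \bar R * \bar R -> R :=
  fun z => G (-oo%E, -oo%E) + G z - G (-oo%E, z.2) - G (z.1, -oo%E).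

Lemma corner_increment_Bc G : Cbar2 G -> Bc (corner_increment G).
Proof.
move=> cG; split=> [z|s]; last by rewrite /corner_increment /=; split; ring.
have c1 : continuous (fun z : \bar R * \bar R => G (z.1, -oo%E)).
  exact: (@continuous_comp_fst _ _ _ (fun s => G (s, -oo%E)) (continuous_section1 cG)).
have c2 : continuous (fun z : \bar R * \bar R => G (-oo%E, z.2)).
  exact: (@continuous_comp_snd _ _ _ (fun s => G (-oo%E, s)) (continuous_section2 cG)).
apply: cvgB; last exact: c1.
apply: cvgB; last exact: c2.
by apply: cvgD; [exact: cvg_cst|exact: cG].
Qed.

Lemma d12_corner_increment G : Cbar2 G -> d12 (corner_increment G) = d12 G.
Proof.
move=> cG; apply/funext => phi; rewrite !d12E.
have tphi : test_functions (set_val phi) := set_mem (valP phi).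
(* The constant G (-oo, -oo) is absorbed into the function of x. *)
pose c1 (x : R) := G (x%:E, -oo%E) - G (-oo%E, -oo%E).
pose c2 (y : R) := G (-oo%E, y%:E).
have cc1 : continuous c1.
  move=> x; apply: cvgB; last exact: cvg_cst.
  apply: (@continuous_comp _ _ _ (@EFin R) (fun s => G (s, -oo%E))).
    exact: continuous_EFin.
  exact: (@continuous_section1 _ _ _ G).
have cc2 : continuous c2.
  move=> y; apply: (@continuous_comp _ _ _ (@EFin R) (fun s => G (-oo%E, s))).
    exact: continuous_EFin.
  exact: (@continuous_section2 _ _ _ G).
have cG' := continuous_real_plane cG.
rewrite (_ : real_plane (corner_increment G) =
   (real_plane G \- (fun z => c1 z.1)) \- (fun z => c2 z.2)); last first.
  by apply/funext => z; rewrite /real_plane /corner_increment /c1 /c2 /=; ring.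
have cc1' : continuous (fun z : R * R => c1 z.1) by exact: continuous_comp_fst.
rewrite pairingB//; last 2 first.
- by move=> z; apply: cvgB; [exact: cG'|exact: cc1'].
- exact: continuous_comp_snd.
by rewrite pairingB// pairing_fst_eq0// pairing_snd_eq0// !subr0.
Qed.

End extended_plane.

(** * The fundamental theorem *)

Theorem proposition4p4 (R : realType) :
  (forall f : test_function R -> R, Ac f ->
     let Phi : \bar R * \bar R -> R :=
       fun z => cpintegral -oo%E z.1 -oo%E z.2 f in
     Bc Phi /\ d12 Phi = f) /\
  (forall G : \bar R * \bar R -> R, Cbar2 G ->
     forall x y : \bar R,
       cpintegral -oo%E x -oo%E y (d12 G) =
       G (-oo%E, -oo%E) + G (x, y) - G (-oo%E, y) - G (x, -oo%E)).
Proof.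
split=> [f [_ [F BF fF]] Phi|G cG x y].
  suff -> : Phi = F by [].
  apply/funext => -[x y].
  rewrite /Phi /cpintegral (Bc_primitiveP BF fF) /=.
  by rewrite !(BF.2 _).1 (BF.2 _).2 add0r !subr0.
have BH := corner_increment_Bc cG.
rewrite /cpintegral (Bc_primitiveP BH (esym (d12_corner_increment cG))).
by rewrite !(BH.2 _).1 (BH.2 _).2 add0r !subr0.
Qed.
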